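(* There exists a positive (absolute) constant $\delta$ such that the following holds. Let $p$ be a prime satisfying $p \equiv 2 \pmod 3$ and let $G$ be a finite abelian group of type I$(p)$. If $0 \le t \le \delta |G|/p$, then every $A \subseteq G$ with $\left(\frac{1}{3} + \frac{1}{3p}\right)|G| + t$ elements satisfies $$\mathrm{ST}(A) \ge \frac{3t|G|}{p} + \mathbf{1}[p \ne 2] \cdot t^2.$$
   Context: A finite abelian group $G$ is of type I$(p)$, where $p$ is a prime with $p \equiv 2 \pmod 3$, if $p$ is the smallest among the prime factors $q$ of $|G|$ satisfying $q \equiv 2 \pmod 3$ (in particular $p$ divides $|G|$). For a subset $A$ of a finite abelian group, $\mathrm{ST}(A) = |\{(x,y,z) \in A^3 : x+y=z\}|$ is the number of (ordered) Schur triples contained in $A$ (elements not necessarily distinct). $\mathbf{1}[p\neq 2]$ equals $1$ if $p \ne 2$ and $0$ if $p = 2$. *)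

(* Defs.v *)
From mathcomp Require Import all_boot all_order all_algebra.

Set Implicit Arguments.
Unset Strict Implicit.
Unset Printing Implicit Defensive.

Import GRing.Theory.
Local Open Scope ring_scope.

Definition typeI (G : finZmodType) (p : nat) : Prop :=
  [/\ prime p, p = 2 %[mod 3], (p %| #|G|)%N &
      forall q : nat, prime q -> (q %| #|G|)%N -> q = 2 %[mod 3] -> (p <= q)%N].

(* A triple (x, y, z) is encoded as the left-nested pair ((x, y), z). *)
Definition schur_triples (G : finZmodType) (A : {set G}) : {set G * G * G} :=
  [set u : G * G * G |
     [&& u.1.1 \in A, u.1.2 \in A, u.2 \in A & u.1.1 + u.1.2 == u.2]].

Definition ST (G : finZmodType) (A : {set G}) : nat := #|schur_triples A|.

(* Main.v *)
Require Import Defs.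
From mathcomp Require Import all_boot all_order all_algebra.
From mathcomp Require Import reals.
From mathcomp Require Import zify ring.

(* Write n = |G|, h = n/p, so that |A| = (n + h)/3 + t.  The engine is a
   truncated form of Kneser's theorem, proved with Pollard's argument: Dyson
   transforms and splittings never increase the representation function, and
   they stop only at a pair (A', B') with B' inside a coset of the stabiliser
   of A'.  Hence either sum_g min(t, rep g) is large, or some C, consisting of
   popular sums, satisfies |C| + |stab C| >= |A| + |B| up to O(t).

   If ST(A) is below the claimed bound, apply this to A - A with t ~ h/32.  The
   first alternative is impossible since ST(A) is the sum of rep over A.  In the
   second, C is nearly disjoint from A, so that |C| < 2n/3 up to O(h), and this
   leaves two values of |C| in terms of m = [G : stab C].  In both cases the
   complement X of C is sum-free; if m = 1 mod 3 this contradicts the bound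
   |X| <= (n + h)/3, and otherwise m is a prime q = 3K+2 with q >= p, close
   to p, and A differs from X by O(h) elements with a small constant.

   Finally let L = |stab C|.  Pollard's inequality for X together with one or two
   further cosets shows that every g outside X lies in at least 3L triples whose
   other members are in X, and that the elements lying in fewer than 4L of them
   pairwise span a triple with an element of X.  The former yields the linear
   term and the latter the quadratic one. *)

Import Order.TTheory GRing.Theory Num.Theory.
Local Open Scope ring_scope.

(** * Representation functions and periodic sets *)

Section Counting.
Variable G : finZmodType.
Implicit Types (A B C D E F H X : {set G}) (g h x y : G).

Definition rep A B g : nat := \sum_x ((x \in A) * (g - x \in B)%R)%N.
Definition trunc_rep (t : nat) A B : nat := \sum_g minn t (rep A B g).
Definition stab A : {set G} := [set h | [forall x, (x + h \in A) == (x \in A)]].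
Definition shift g A : {set G} := [set x | x - g \in A].
Definition opp_set A : {set G} := [set x | - x \in A].

Lemma stabP A h : reflect (forall x, (x + h \in A) = (x \in A)) (h \in stab A).
Proof.
rewrite inE; apply: (iffP forallP) => hA x; first exact/eqP.
by rewrite hA.
Qed.

Lemma stab0 A : 0 \in stab A.
Proof. by apply/stabP => x; rewrite addr0. Qed.

Lemma stabB A g h : g \in stab A -> h \in stab A -> g - h \in stab A.
Proof.
move=> /stabP gA /stabP hA; apply/stabP => x.
by rewrite -(hA (x + _)) -addrA subrK gA.
Qed.

Lemma card_shift g A : #|shift g A| = #|A|.
Proof.
have -> : shift g A = [set x + g | x in A].
  apply/setP => x; rewrite inE; apply/idP/imsetP => [xA|[y yA ->]].
    by exists (x - g); rewrite ?subrK.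
  by rewrite addrK.
exact/card_imset/addIr.
Qed.

Lemma card_opp_set A : #|opp_set A| = #|A|.
Proof.
have -> : opp_set A = [set - x | x in A].
  apply/setP => x; rewrite inE; apply/idP/imsetP => [xA|[y yA ->]].
    by exists (- x); rewrite ?opprK.
  by rewrite opprK.
exact/card_imset/oppr_inj.
Qed.

Lemma card_mem_sum A : #|A| = (\sum_x (x \in A))%N.
Proof. by rewrite -sum1_card big_mkcond; apply: eq_bigr => x _; case: (x \in A). Qed.

Definition subgroup H := 0 \in H /\ forall x y, x \in H -> y \in H -> x - y \in H.

Lemma stab_subgroup A : subgroup (stab A).
Proof. by split=> [|x y]; [exact: stab0 | exact: stabB]. Qed.

Lemma subgroupN H x : subgroup H -> (- x \in H) = (x \in H).
Proof.
case=> H0 HB; apply/idP/idP => hx; last by rewrite -sub0r HB.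
by rewrite -[x]opprK -[- - x]sub0r HB.
Qed.

Lemma subgroupD H x y : subgroup H -> x \in H -> y \in H -> x + y \in H.
Proof. by move=> sH; case: (sH) => _ HB xH yH; rewrite -[y]opprK HB ?subgroupN. Qed.

Lemma subgroupDl H x y : subgroup H -> y \in H -> (x + y \in H) = (x \in H).
Proof.
move=> sH yH; apply/idP/idP => xH; last exact: subgroupD.
by rewrite -(addrK y x); case: sH => _; apply.
Qed.

Lemma shift_stab H g : subgroup H -> H \subset stab (shift g H).
Proof.
move=> sH; apply/subsetP => h hH; apply/stabP => x.
by rewrite !inE addrAC subgroupDl.
Qed.

Lemma shift_sub H X g : H \subset stab X -> (0 : G) \in H -> g \in X -> shift g H \subset X.
Proof.
move=> HX H0 gX; apply/subsetP => x; rewrite inE => /(subsetP HX)/stabP/(_ g).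
by rewrite addrC subrK gX.
Qed.

Lemma periodicU H A B : H \subset stab A -> H \subset stab B -> H \subset stab (A :|: B).
Proof.
move=> /subsetP HA /subsetP HB; apply/subsetP => h hH; apply/stabP => x.
by rewrite !inE (stabP _ _ (HA h hH)) (stabP _ _ (HB h hH)).
Qed.

Lemma periodicI H A B : H \subset stab A -> H \subset stab B -> H \subset stab (A :&: B).
Proof.
move=> /subsetP HA /subsetP HB; apply/subsetP => h hH; apply/stabP => x.
by rewrite !inE (stabP _ _ (HA h hH)) (stabP _ _ (HB h hH)).
Qed.

Lemma periodicC H A : H \subset stab A -> H \subset stab (~: A).
Proof.
move=> /subsetP HA; apply/subsetP => h hH; apply/stabP => x.
by rewrite !inE (stabP _ _ (HA h hH)).
Qed.

Lemma periodicD H A B : H \subset stab A -> H \subset stab B -> H \subset stab (A :\: B).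
Proof. by move=> HA HB; rewrite setDE; apply: periodicI => //; exact: periodicC. Qed.

Lemma periodic_shift H A g : H \subset stab A -> H \subset stab (shift g A).
Proof.
move=> /subsetP HA; apply/subsetP => h hH; apply/stabP => x.
by rewrite !inE addrAC (stabP _ _ (HA h hH)).
Qed.

Lemma periodic_opp H A : subgroup H -> H \subset stab A -> H \subset stab (opp_set A).
Proof.
move=> sH /subsetP HA; apply/subsetP => h hH; apply/stabP => x.
by rewrite !inE opprD; apply/stabP/HA; rewrite subgroupN.
Qed.

(** Periodic sets are disjoint unions of cosets; the induction removes one coset at a time. The case
    of the whole group is Lagrange's theorem. *)
Lemma periodic_dvd H X : subgroup H -> H \subset stab X -> (#|H| %| #|X|)%N.
Proof.
move=> sH; move: {2}#|X| (leqnn #|X|) => m.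
elim: m X => [|m IH] X Xm HX; first by move: Xm; rewrite leqn0 => /eqP ->.
have [->|[g gX]] := set_0Vmem X; first by rewrite cards0.
have gH : shift g H \subset X by apply: shift_sub; case: sH.
rewrite -(cardsID (shift g H) X) (setIidPr gH) card_shift dvdn_addr //.
apply: IH; last by apply: periodicD => //; apply: shift_stab.
have := cardsID (shift g H) X; rewrite (setIidPr gH) card_shift.
have : (0 < #|H|)%N by apply/card_gt0P; exists 0; case: sH.
lia.
Qed.

Lemma rep_leB A B g : (rep A B g <= #|B|)%N.
Proof.
rewrite card_mem_sum (reindex_inj (inv_inj (subKr g))) /=.
by apply: leq_sum => x _; case: (_ \in A); rewrite ?mul1n.
Qed.

Lemma sum_rep A B : (\sum_g rep A B g = #|A| * #|B|)%N.
Proof.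
rewrite exchange_big /= [#|A|]card_mem_sum big_distrl /=; apply: eq_bigr => x _.
rewrite -big_distrr /= card_mem_sum; congr muln.
by rewrite [RHS](reindex_inj (addIr (- x))).
Qed.

(** The first pair is the Dyson transform of [(A, B)] by [e], the second is what the transform
    leaves over. Keeping the first pair alone, or both, gives the two reductions in
    [pollard_kneser]. *)
Lemma rep_split A B e g :
  (rep (A :|: shift e B) (B :&: shift (- e) A) g +
   rep (A :\: shift e B) (B :\: shift (- e) A) g <= rep A B g)%N.
Proof.
rewrite /rep -big_split /=.
(* The inequality is an identity after averaging over the involution
   x |-> g + e - x, which exchanges the roles of A and B + e. *)
have ref f : (\sum_x f x = \sum_x f ((g + e) - x)%R :> nat)%N.
  by rewrite (reindex_inj (inv_inj (subKr (g + e)))).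
have dbl f : ((\sum_x f x).*2 = \sum_x (f x + f (g + e - x)%R))%N.
  by rewrite -addnn {2}ref big_split.
rewrite -leq_double !dbl.
apply: leq_sum => x _; rewrite !inE !opprK.
have -> : g - (g + e - x) = x - e by rewrite opprB addrCA opprD addNKr.
have -> : g + e - x - e = g - x by rewrite addrAC addrK.
have -> : g - x + e = g + e - x by rewrite addrAC.
rewrite subrK.
by case: (x \in A); case: (x - e \in B); case: (g + e - x \in A); case: (g - x \in B).
Qed.

End Counting.

Arguments rep {G}.
Arguments trunc_rep {G}.
Arguments stab {G}.
Arguments shift {G}.
Arguments opp_set {G}.
Arguments subgroup {G}.

(** * The truncated Kneser theorem *)

(** Arithmetic of the splitting: [s] is the size of the part split off, [d] the level left for the
    remainders, whose sizes are [a] and [b]. Adding the two hypotheses leaves a slack of [s * T]. *)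
Lemma pollard_split_arith (a b s d T N N' : nat) :
  (d * (a + b) <= N' + d * (d + T) -> (a + b + s) * s + N' <= N ->
  (d + s) * (a + s + (b + s)) <= N + (d + s) * (d + s + T))%N.
Proof. have := leq0n (s * T)%N; nia. Qed.

Section Core.
Variable G : finZmodType.
Implicit Types (A B C H : {set G}) (g h x y : G).

(** Induction on [#|B|]. From the terminal pair [(A', B')] come [C], a translate of [A'], and
    [beta = #|B'|]; [sigma] is the total size of the parts split off, and [T] is the tolerated
    error. All sets stay [H]-periodic, so sizes and levels are multiples of [#|H|]. *)
Lemma pollard_kneser H A B (t T : nat) :
  subgroup H -> H \subset stab A -> H \subset stab B -> (#|H| %| t)%N ->
  (0 < t)%N -> (t <= #|A|)%N -> (t <= #|B|)%N ->
  (t * (#|A| + #|B|) <= trunc_rep t A B + t * (t + T))%N \/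
  exists C (beta sigma : nat),
    [/\ (0 < #|C|)%N, H \subset stab C, (sigma + #|H| <= t)%N &
        [/\ (T < beta)%N, (t < beta + sigma)%N, (beta <= #|stab C|)%N,
            (#|C| + beta + 2 * sigma = #|A| + #|B|)%N &
            forall g, g \in C -> (beta <= rep A B g)%N]].
Proof.
move=> sH; move: {2}#|B| (leqnn #|B|) => m.
elim: m A B t => [|m IH] A B t Bm HA HB Ht t0 tA tB.
  by move: (leq_trans t0 (leq_trans tB Bm)).
have H0 : (0 < #|H|)%N by apply/card_gt0P; exists 0; case: sH.
have [tBe|tBlt] : (t = #|B|)%N \/ (t < #|B|)%N by lia.
  left; have -> : (trunc_rep t A B = #|A| * #|B|)%N.
    rewrite -sum_rep; apply: eq_bigr => g _.
    by apply/minn_idPr; rewrite tBe rep_leB.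
  by rewrite -tBe; nia.
pose I e := B :&: shift (- e) A; pose U e := A :|: shift e B.
have HI e : H \subset stab (I e) by apply: periodicI => //; apply: periodic_shift.
have HU e : H \subset stab (U e) by apply: periodicU => //; apply: periodic_shift.
have IB e : (#|I e| <= #|B|)%N by apply/subset_leq_card/subsetIl.
have UI e : (#|U e| + #|I e| = #|A| + #|B|)%N.
  have -> : #|I e| = #|A :&: shift e B|.
    by rewrite -(card_shift _ e); apply: eq_card => x; rewrite !inE opprK subrK andbC.
  by rewrite cardsUI card_shift.
have cDA e : (#|A :\: shift e B| + #|I e| = #|A|)%N.
  have -> : #|I e| = #|A :&: shift e B|.
    by rewrite -(card_shift _ e); apply: eq_card => x; rewrite !inE opprK subrK andbC.
  by rewrite addnC cardsID.
have cDB e : (#|B :\: shift (- e) A| + #|I e| = #|B|)%N.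
  by rewrite -(cardsID (shift (- e) A) B) addnC.
have [/existsP[e /andP[te eB]]|big] := boolP [exists e, (t <= #|I e| < #|B|)%N].
  have repI g : (rep (U e) (I e) g <= rep A B g)%N.
    by apply: leq_trans (rep_split _ A B e g); apply: leq_addr.
  have [|||||||le|[C [beta [sigma [C0 HC st [Tb tb bC Cs rC]]]]]] := IH (U e) (I e) t => //.
  - by lia.
  - by have := UI e; lia.
  - left; rewrite -(UI e); apply: (leq_trans le); rewrite leq_add2r.
    apply: leq_sum => g _; have := repI g; lia.
  - right; exists C, beta, sigma; split=> //; split=> //; first by rewrite Cs UI.
    by move=> g /rC /leq_trans; apply.
(* An intersection of size [s < t] is split off: [rep (U e) (I e)] never exceeds [s], so it is
   counted without truncation, and the level [t - s] remains for the differences. *)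
have [/existsP[e /andP[e0 et]]|small] := boolP [exists e, (0 < #|I e| < t)%N].
  set s := #|I e| in e0 et.
  have Hs : (#|H| %| s)%N by apply: periodic_dvd.
  have Hst : (#|H| %| t - s)%N by apply: dvdn_sub.
  set A' := A :\: shift e B; set B' := B :\: shift (- e) A.
  have eA' : (#|A'| + s = #|A|)%N := cDA e.
  have eB' : (#|B'| + s = #|B|)%N := cDB e.
  have [|||||||le|[C [beta [sigma [C0 HC st [Tb tb bC Cs rC]]]]]] := IH A' B' (t - s)%N => //;
    try lia.
  - by apply: periodicD => //; apply: periodic_shift.
  - by apply: periodicD => //; apply: periodic_shift.
  - left.
    have tr : (#|U e| * s + trunc_rep (t - s) A' B' <= trunc_rep t A B)%N.
      rewrite -sum_rep -big_split; apply: leq_sum => g _.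
      have := rep_split _ A B e g; have := rep_leB _ (U e) (I e) g.
      rewrite -/(I e) -/(U e) -/s -/A' -/B' /=; lia.
    have eU : #|U e| = (#|A'| + #|B'| + s)%N by have := UI e; rewrite -/s; lia.
    rewrite -eA' -eB' -(subnK (ltnW et)); apply: pollard_split_arith le _.
    by rewrite -eU (subnK (ltnW et)).
  - right; exists C, beta, (sigma + s)%N; split=> //; first by lia.
    split=> //; try lia.
    by move=> g /rC /leq_trans; apply; apply: leq_trans (rep_split _ A B e g); apply: leq_addl.
(* No transform applies any more: a translate of B meeting A is contained in A. *)
have stuck e b : b \in B -> b + e \in A -> forall x, x \in B -> x + e \in A.
  move=> bB beA x xB.
  have e0 : (0 < #|I e|)%N by apply/card_gt0P; exists b; rewrite !inE opprK bB.
  have eI : (#|I e| = #|B|)%N.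
    move: big small; rewrite !negb_exists => /forallP/(_ e) b1 /forallP/(_ e) b2.
    have := IB e; lia.
  have /eqP eqB : I e == B by rewrite eqEcard subsetIl eI leqnn.
  by move: xB; rewrite -eqB !inE opprK => /andP[].
have stAB x y : x \in B -> y \in B -> x - y \in stab A.
  move=> xB yB.
  suff st u v : u \in B -> v \in B -> forall z, z \in A -> z + (u - v) \in A.
    apply/stabP => z; apply/idP/idP; last exact: st.
    by move=> /(st _ _ yB xB); rewrite -addrA -(opprB x y) subrr addr0.
  move=> uB vB z zA; rewrite addrCA; apply: (stuck (z - v) v) => //.
  by rewrite addrC subrK.
have [b bB] : exists b, b \in B by apply/card_gt0P; lia.
have BsubS : (#|B| <= #|stab A|)%N.
  rewrite -(card_shift _ (- b) B); apply: subset_leq_card; apply/subsetP => x.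
  by rewrite inE opprK => xB; rewrite -(addrK b x); apply: stAB.
have repA g : rep A B g = ((g - b \in A)%R * #|B|)%N.
  rewrite (card_mem_sum _ B) big_distrr /= /rep (reindex_inj (inv_inj (subKr g))) /=.
  apply: eq_bigr => x _; rewrite subKr; case xB: (x \in B); rewrite ?muln0 ?muln1 //.
  by rewrite -(stabP _ _ _ (stAB x b xB bB) (g - x)) addrA subrK.
(* A terminal [B] of size at most [T] costs at most [t * T], which the first alternative allows; a
   larger one makes every point of [shift b A] popular. *)
have [TB|BT] := ltnP T #|B|.
  right; exists (shift b A), #|B|, 0%N; split; rewrite ?add0n.
  - by rewrite card_shift; lia.
  - exact: periodic_shift.
  - exact: dvdn_leq.
  split=> //; rewrite ?addn0 ?card_shift ?muln0 //.
    apply: (leq_trans BsubS); apply: subset_leq_card; exact: periodic_shift.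
  by move=> g; rewrite inE repA => ->; rewrite mul1n.
left; have -> : trunc_rep t A B = (t * #|A|)%N.
  rewrite -(card_shift _ b A) (card_mem_sum _ (shift b A)) big_distrr /=.
  apply: eq_bigr => g _; rewrite repA inE; case: (_ \in A); rewrite ?mul1n ?muln1 ?mul0n ?muln0 //.
  by apply/minn_idPl; lia.
nia.
Qed.

End Core.

(** * Schur triples *)

Section Triples.
Variable G : finZmodType.
Implicit Types (A B C D E F H X : {set G}) (g h x y : G).

Definition triples A B C : nat :=
  (\sum_x \sum_y (x \in A) * (y \in B) * (x + y \in C)%R)%N.

Lemma ST_triples A : ST A = triples A A A.
Proof.
rewrite /ST -sum1_card big_mkcond /triples pair_bigA /=.
transitivity (\sum_(p : G * G) \sum_z (if (p, z) \in schur_triples A then 1 else 0))%N.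
  by rewrite pair_bigA; apply: eq_bigr => -[].
apply: eq_bigr => -[x y] _ /=; rewrite (bigD1 (x + y)) //= big1 ?addn0 => [|z nz].
  by rewrite inE /= eqxx andbT; case: (x \in A); case: (y \in A); case: (_ \in A).
by rewrite inE /= eq_sym (negbTE nz) !andbF.
Qed.

Lemma triples_le A B C A' B' C' :
  A \subset A' -> B \subset B' -> C \subset C' -> (triples A B C <= triples A' B' C')%N.
Proof.
move=> /subsetP AA /subsetP BB /subsetP CC; apply: leq_sum => x _; apply: leq_sum => y _.
case xA: (x \in A) => //; case yB: (y \in B) => //; case xyC: (x + y \in C) => //.
by rewrite AA ?BB ?CC.
Qed.

Lemma triplesC A B C : triples A B C = triples B A C.
Proof.
rewrite /triples exchange_big; apply: eq_bigr => y _; apply: eq_bigr => x _.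
by rewrite [y + x]addrC [((y \in B) * _)%N]mulnC.
Qed.

Lemma rep_opp A g : rep A (opp_set A) g = (\sum_y (y \in A) * (g + y \in A)%R)%N.
Proof.
rewrite /rep (reindex_inj (addrI g)) /=; apply: eq_bigr => y _.
by rewrite inE opprB addrAC subrr add0r mulnC.
Qed.

Lemma ST_rep A : ST A = (\sum_(g in A) rep A (opp_set A) g)%N.
Proof.
rewrite ST_triples [RHS]big_mkcond; apply: eq_bigr => g _; rewrite rep_opp.
by case: (g \in A); [apply: eq_bigr => y _; rewrite mul1n | apply: big1].
Qed.

(** Each term outside [A] is at most [t], and the untruncated terms on [A] add up to [ST A]. This
    turns lower bounds for [trunc_rep] into lower bounds for [ST]. *)
Lemma trunc_rep_ST A t : (trunc_rep t A (opp_set A) <= t * (#|G| - #|A|) + ST A)%N.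
Proof.
rewrite /trunc_rep (bigID (mem A)) /= addnC; apply: leq_add.
  have -> : (#|G| - #|A| = #|~: A|)%N by rewrite -(cardsC A) addKn.
  rewrite mulnC -sum_nat_const [leqRHS](eq_bigl (fun x => x \notin A)) => [|x]; last by rewrite inE.
  by apply: leq_sum => x _; apply: geq_minl.
by rewrite ST_rep; apply: leq_sum => x _; apply: geq_minr.
Qed.

Lemma popular_ST A C (beta : nat) :
  (forall g, g \in C -> (beta <= rep A (opp_set A) g)%N) -> (beta * #|A :&: C| <= ST A)%N.
Proof.
move=> hC; rewrite ST_rep mulnC -sum_nat_const big_mkcond [leqRHS]big_mkcond /=.
by apply: leq_sum => g _; rewrite inE; case: (g \in A) => //=; case gC: (g \in C) => //=; apply: hC.
Qed.

(** For each [x] in [A] and in the coset of [u], the part of [A] in the coset of [v] and the part in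
    the coset of [u + v] moved by [- x] lie in one coset, so they overlap by inclusion-exclusion. *)
Lemma coset_triples H A u v : subgroup H ->
  (#|A :&: shift u H| * (#|A :&: shift v H| + #|A :&: shift (u + v)%R H| - #|H|) <= ST A)%N.
Proof.
move=> sH; rewrite ST_triples -sum_nat_const big_mkcond.
apply: leq_sum => x _; case xA: (_ \in _) => //.
move: xA; rewrite !inE => /andP[-> xH].
set D := _ :&: shift v H; set E := _ :&: _.
have hE : #|shift (- x) E| = #|E| by rewrite card_shift.
have hU : (#|D :|: shift (- x) E| <= #|H|)%N.
  rewrite -(card_shift _ v H); apply: subset_leq_card; apply/subsetP => y.
  rewrite !inE opprK => /orP[/andP[]|/andP[_]] //.
  have -> : y + x - (u + v) = y - v + (x - u) by rewrite (addrC u) opprD addrACA.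
  by rewrite subgroupDl.
have hI : (#|D :&: shift (- x) E| <= \sum_y 1 * (y \in A) * (x + y \in A)%R)%N.
  rewrite card_mem_sum; apply: leq_sum => y _; rewrite !inE opprK [y + x]addrC mul1n.
  by case: (y \in A); case: (x + y \in A); rewrite ?andbF //=; case: (_ && _).
apply: (leq_trans _ hI); have := cardsUI D (shift (- x) E); lia.
Qed.

Lemma coset_eq H u v : subgroup H -> u - v \in H -> shift u H = shift v H.
Proof.
by move=> sH uv; apply/setP => x; rewrite !inE -(subgroupDl _ _ (x - u) _ sH uv) addrA subrK.
Qed.

Lemma coset_disjoint H u v : subgroup H -> u - v \notin H -> [disjoint shift u H & shift v H].
Proof.
move=> sH; apply: contraR => /pred0Pn[x /=]; rewrite !inE => /andP[xu xv].
by case: (sH) => _ /(_ _ _ xv xu); rewrite opprB addrC addrA subrK.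
Qed.

Definition sumfree X := forall x y, x \in X -> y \in X -> x + y \notin X.

Lemma sumfree_ST X : sumfree X <-> ST X = 0%N.
Proof.
rewrite ST_triples; split=> [sX|/eqP].
  apply: big1 => x _; apply: big1 => y _.
  case xX: (x \in X) => //; case yX: (y \in X) => //.
  by rewrite (negbTE (sX _ _ xX yX)).
rewrite sum_nat_eq0 => /forallP s0 x y xX yX.
by have := s0 x; rewrite sum_nat_eq0 => /forallP/(_ y); rewrite xX yX /= !mul1n eqb0.
Qed.

(* A Schur triple in X would give three cosets in which A is so dense that A itself
   contains at least |H|^2 / 9 triples. *)
Lemma almost_periodic_sumfree H X A :
  subgroup H -> H \subset stab X -> (3 * #|X :\: A| <= 2 * #|H|)%N ->
  (2 * #|H| <= #|X|)%N \/ (3 * #|X :\: A| <= #|H|)%N ->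
  (9 * ST A < #|H| ^ 2)%N -> sumfree X.
Proof.
move=> sH HX holes large fewST.
have H0 : (0 < #|H|)%N by apply/card_gt0P; exists 0; case: sH.
have cos u : u \in X -> shift u H \subset X by apply: shift_sub => //; case: sH.
have one u : u \in X -> (#|H| <= #|A :&: shift u H| + #|X :\: A|)%N.
  move=> uX; rewrite -(card_shift _ u H) -(cardsID A (shift u H)) setIC leq_add2l.
  by apply/subset_leq_card/setSD/cos.
have two u v : u \in X -> v \in X -> u - v \notin H ->
    (2 * #|H| <= #|A :&: shift u H| + #|A :&: shift v H| + #|X :\: A|)%N.
  move=> uX vX uv.
  have dis := coset_disjoint H u v sH uv.
  have -> : (2 * #|H| = #|shift u H :|: shift v H|)%N.
    by move: dis; rewrite -leq_card_setU => /eqP ->; rewrite !card_shift; lia.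
  rewrite -(cardsID A); apply: leq_add; last by apply/subset_leq_card/setSD; rewrite subUset !cos.
  by rewrite setIUl ![_ :&: A]setIC leq_card_setU.
move=> x y xX yX; apply/negP => xyX.
(* Two such cosets overlap in at least [#|H| / 3] points, and [A] has at least [#|H| / 3] points in
   the coset of [x]: the product contradicts [fewST]. *)
suff [v [vX vxX]] : exists v, [/\ v \in X & (4 * #|H| <= 3 * (#|A :&: shift v H| + #|A :&: shift
  (x + v)%R H|))%N].
  have := coset_triples H A x v sH; have := one _ xX; nia.
have [le|gt] := leqP (3 * #|X :\: A|) #|H|.
  by exists y; split=> //; have := one _ yX; have := one _ xyX; lia.
have XL : (2 * #|H| <= #|X|)%N by case: large => //; lia.
have [xH|xH] := boolP (x \in H); last first.
  exists y; split=> //.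
  have := two (x + y) y xyX yX; rewrite addrK xH => /(_ isT); lia.
(* For [x] in [H] the cosets of [v] and [x + v] coincide, so a single coset must be two thirds full;
   the denser of two distinct cosets in [X] is. *)
have eqc v : shift (x + v) H = shift v H by apply: coset_eq; rewrite ?addrK.
have [v vX vy] : exists2 v, v \in X & v - y \notin H.
  have /subsetPn[v vX vy] : ~~ (X \subset shift y H).
    by apply/negP => /subset_leq_card; rewrite card_shift; lia.
  by exists v => //; move: vy; rewrite inE.
have := two v y vX yX vy => le.
have [l|l] := leqP #|A :&: shift y H| #|A :&: shift v H|; [exists v|exists y]; split;
  rewrite ?eqc //; lia.
Qed.


End Triples.

Arguments triples {G}.
Arguments sumfree {G}.

(** * Sum-free sets in groups of type I(p) *)

(** A product of primes congruent to 0 or 1 modulo 3 is itself congruent to 0 or 1. *)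
Lemma prime_divisor_2mod3 m : (m %% 3 = 2)%N -> exists2 q, prime q & (q %| m)%N && (q %% 3 == 2)%N.
Proof.
elim/ltn_ind: m => m IH m2.
have m1 : (1 < m)%N by case: m m2 {IH} => [|[|]].
have qp := pdiv_prime m1; have qm := pdiv_dvd m; set q := pdiv m in qp qm *.
have [q2|q2] := eqVneq (q %% 3)%N 2; first by exists q; rewrite ?qm ?q2.
have em : m = (m %/ q * q)%N by rewrite divnK.
have q1 := prime_gt1 qp.
have [||r rp /andP[rm r2]] := IH (m %/ q)%N.
- by rewrite ltn_Pdiv // ltnW.
- move: m2 q2; rewrite {1}em -modnMm; case: (q %% 3)%N (ltn_pmod q (isT : 0 < 3)%N) =>
  [|[|[|//]]] // _.
    by rewrite muln0.
  by rewrite muln1 modn_mod.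
by exists r => //; rewrite r2 andbT em dvdn_mulr.
Qed.

Section Exact.
Variable G : finZmodType.
Implicit Types (A B C D E F H X : {set G}) (g h x y : G).

Lemma typeI_index p m : typeI G p -> (m %| #|G|)%N -> (m %% 3 = 2)%N -> (p <= m)%N.
Proof.
move=> [_ _ _ pmin] mG m2; have [q qp /andP[qm /eqP q2]] := prime_divisor_2mod3 m m2.
apply: leq_trans (dvdn_leq _ qm); last by case: m m2 {qm mG}.
by apply: pmin => //; apply: dvdn_trans mG.
Qed.

(** A prime divisor of [m] congruent to 2 modulo 3 is at least [p], so [m < 2 * p] leaves no room
    for a cofactor. *)
Lemma typeI_index_prime p m : typeI G p -> (m %| #|G|)%N -> (m %% 3 = 2)%N -> (m < 2 * p)%N ->
  prime m.
Proof.
move=> pI mG m2 mp; have [q qp /andP[qm /eqP q2]] := prime_divisor_2mod3 m m2.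
have pq : (p <= q)%N by apply: (typeI_index _ _ pI) => //; apply: dvdn_trans mG.
case/dvdnP: qm => k ek; suff k1 : k = 1%N by rewrite ek k1 mul1n.
by case: k ek => [|[|k]] ek //; [rewrite ek in m2|nia].
Qed.

Lemma card_finZmod_gt0 : (0 < #|G|)%N.
Proof. by apply/card_gt0P; exists 0. Qed.

Lemma subgroup_gt0 H : subgroup H -> (0 < #|H|)%N.
Proof. by case=> H0 _; apply/card_gt0P; exists 0. Qed.

Lemma subgroup_dvd H : subgroup H -> (#|H| %| #|G|)%N.
Proof.
move=> sH; rewrite -cardsT; apply: periodic_dvd => //.
by apply/subsetP => h _; apply/stabP => x; rewrite !inE.
Qed.

Lemma subgroup0 : subgroup [set (0 : G)].
Proof. by split=> [|x y]; rewrite !inE // => /eqP -> /eqP ->; rewrite subrr. Qed.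

Lemma periodic0 X : [set 0] \subset stab X.
Proof. by rewrite sub1set stab0. Qed.

Lemma typeI_cofactor p : typeI G p -> (0 < #|G| %/ p)%N /\ (p * (#|G| %/ p) = #|G|)%N.
Proof.
move=> [/prime_gt0 p0 _ pG _]; rewrite mulnC divnK //; split=> //.
by rewrite divn_gt0 // dvdn_leq // card_finZmod_gt0.
Qed.

Lemma typeI_index_card p H : typeI G p -> subgroup H ->
  ((#|G| %/ #|H|) %% 3 = 2)%N -> (#|H| <= #|G| %/ p)%N.
Proof.
move=> pI sH m2; have [h0 eh] := typeI_cofactor _ pI.
have HG := subgroup_dvd _ sH.
have := typeI_index _ _ pI (dvdn_div HG) m2; have := divnK HG.
have := subgroup_gt0 _ sH.
set m := (_ %/ #|H|)%N; set h := (_ %/ p)%N in eh *; nia.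
Qed.

(** The Diananda-Yap bound. Level 1 with error 0 in [pollard_kneser] forces [sigma = 0], which is
    Kneser's theorem. *)
Lemma sumfree_bound p X : typeI G p -> sumfree X -> (3 * #|X| <= #|G| + #|G| %/ p)%N.
Proof.
move=> pI sX; have [h0 eh] := typeI_cofactor _ pI; set h := (_ %/ p)%N in h0 eh *.
have ST0 : ST (set0 : {set G}) == 0%N by apply/eqP/sumfree_ST => x y; rewrite inE.
(* For a largest sum-free Y, the complement of C is sum-free and contains Y, so
   it equals Y; this is what excludes an index congruent to 1 modulo 3. *)
case: (@arg_maxnP _ set0 (fun Y : {set G} => ST Y == 0%N) (fun Y => #|Y|) ST0) =>
  Y /eqP/sumfree_ST sY Ymax.
apply: leq_trans (_ : 3 * #|Y| <= _)%N.
  by rewrite leq_mul2l; apply/orP; right; apply/Ymax/eqP/sumfree_ST.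
rewrite leqNgt; apply/negP => Ybig.
have STY : ST Y = 0%N by apply/sumfree_ST.
have Y0 : (0 < #|Y|)%N by lia.
have [||||le|] := pollard_kneser G [set 0] Y (opp_set Y) 1 0 subgroup0 (periodic0 _) (periodic0
  _) => //.
- by rewrite cards1.
- by rewrite card_opp_set.
- move: le; rewrite card_opp_set => le; have := trunc_rep_ST _ Y 1; have := max_card (mem Y); lia.
case=> C [beta [sigma [C0 _]]]; rewrite cards1 card_opp_set.
case: sigma => [_|]; last by lia.
case=> b0 _ bC Cs rC.
have CY : [disjoint C & Y].
  have := popular_ST _ _ _ _ rC; rewrite STY leqn0 muln_eq0 => /orP[|]; first by lia.
  by rewrite cards_eq0 setI_eq0 disjoint_sym.
have CYn : (#|C| + #|Y| <= #|G|)%N by rewrite -(cardsC C) leq_add2l subset_leq_card //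
  -disjoints_subset disjoint_sym.
have sK := stab_subgroup G C; set K := stab C in bC sK.
have L0 := subgroup_gt0 _ sK.
have [c ec] := dvdnP (periodic_dvd _ _ _ sK (subxx _)).
have [m em] := dvdnP (subgroup_dvd _ sK).
have dm : (#|G| %/ #|K|)%N = m by rewrite em mulnK.
have m2 : (m %% 3 = 2 -> #|K| <= h)%N by rewrite -dm; apply: typeI_index_card.
have c_ub : (3 * c < 2 * m)%N by nia.
have c_lb : (2 * m < 3 * c + 3)%N by nia.
(* The first value gives [m] congruent to 2 modulo 3, hence [#|K| <= h], against [c_ub]; the second
   gives [m] congruent to 1. *)
have [e|e] : (3 * c + 1 = 2 * m \/ 3 * c + 2 = 2 * m)%N by lia.
  have := m2 ltac:(lia); nia.
have cC : (#|C| + #|~: C| = #|G|)%N := cardsC C.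
have e3 : (3 * #|C| + 2 * #|K| = 2 * #|G|)%N by rewrite ec em; nia.
have c2 : (2 * #|K| <= #|~: C|)%N.
  have c0 : (0 < c)%N by case: (c) ec C0 => // ->.
  have m4 : (4 <= m)%N by lia.
  by rewrite em in cC; nia.
have sC : sumfree (~: C).
  have YC : Y \subset ~: C by rewrite -disjoints_subset disjoint_sym.
  have cD := cardsDS YC; have := subset_leq_card YC.
  move=> cl; apply: (almost_periodic_sumfree _ K _ Y) => //.
  - by apply: periodicC.
  - by lia.
  - by left.
  - by rewrite STY muln0 expn_gt0 L0.
have STC : ST (~: C) == 0%N by apply/eqP/sumfree_ST.
have le : (#|~: C| <= #|Y|)%N := Ymax _ STC. lia.
Qed.

End Exact.

(** * Perturbations of periodic sum-free sets *)

Section Degrees.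
Variable G : finZmodType.
Implicit Types (A B C D E F H X : {set G}) (g h x y : G).

Lemma triples_subadd1 A A1 A2 B C : A \subset A1 :|: A2 ->
  (triples A B C <= triples A1 B C + triples A2 B C)%N.
Proof.
move=> /subsetP AA; rewrite -big_split; apply: leq_sum => x _.
rewrite -big_split; apply: leq_sum => y _; case xA: (x \in A) => //.
by have := AA x xA; rewrite inE => /orP[] ->; [apply: leq_addr | apply: leq_addl].
Qed.

Lemma triples_subadd3 A B C C1 C2 : C \subset C1 :|: C2 ->
  (triples A B C <= triples A B C1 + triples A B C2)%N.
Proof.
move=> /subsetP CC; rewrite -big_split; apply: leq_sum => x _.
rewrite -big_split; apply: leq_sum => y _; case xC: (x + y \in C); rewrite ?muln0 //.
by have := CC _ xC; rewrite inE => /orP[] ->; [apply: leq_addr | apply: leq_addl].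
Qed.

Lemma triples_card13 A B C : (triples A B C <= #|A| * #|C|)%N.
Proof.
rewrite card_mem_sum big_distrl; apply: leq_sum => x _ /=.
have -> : (#|C| = \sum_y (x + y \in C)%R)%N by rewrite card_mem_sum (reindex_inj (addrI x)).
rewrite big_distrr /=; apply: leq_sum => y _.
by case: (x \in A); case: (y \in B); rewrite ?mul1n ?mul0n.
Qed.

(* For g outside X, the number of Schur triples containing g whose other two
   members lie in X; the factor 2 is for g as first or second summand. *)
Definition deg X g : nat :=
  (\sum_x (x \in X) * (g - x \in X)%R + 2 * \sum_x (x \in X) * (g + x \in X)%R)%N.

Lemma sum_deg X B : (\sum_(b in B) deg X b = triples X X B + 2 * triples B X X)%N.
Proof.
rewrite big_split -big_distrr /=; congr (_ + 2 * _)%N.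
  rewrite exchange_big /=; apply: eq_bigr => x _; rewrite big_mkcond (reindex_inj (addrI x)) /=.
  apply: eq_bigr => y _; rewrite addrAC subrr add0r.
  by case: (_ \in B); rewrite ?muln1 ?muln0.
rewrite big_mkcond; apply: eq_bigr => b _; case: (b \in B); last by rewrite big1.
by apply: eq_bigr => x _; rewrite mul1n.
Qed.

(* The terms stand for the triples (f, f', x), for (f, x, f') together with
   (x, f, f'), and for those inside F. *)
Definition pair_weight X F f f' : nat :=
  ((f + f' \in X)%R + 2 * (f' - f \in X)%R + (f + f' \in F)%R)%N.

Lemma sum_pair_weight X F :
  (\sum_(f in F) \sum_(f' in F) pair_weight X F f f' =
   triples F F X + 2 * triples F X F + triples F F F)%N.
Proof.
have F1 C : (\sum_(f in F) \sum_(f' in F) (f + f' \in C)%R = triples F F C)%N.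
  rewrite big_mkcond; apply: eq_bigr => f _; case: (f \in F); last by rewrite big1.
  by rewrite big_mkcond; apply: eq_bigr => f' _; case: (f' \in F); rewrite ?mul1n.
have F2 : (\sum_(f in F) \sum_(f' in F) (f' - f \in X)%R = triples F X F)%N.
  rewrite big_mkcond; apply: eq_bigr => f _; case: (f \in F); last by rewrite big1.
  rewrite big_mkcond (reindex_inj (addrI f)); apply: eq_bigr => x _ /=.
  by rewrite addrAC subrr add0r; case: (x \in X); case: (_ \in F).
rewrite -!F1 -F2 big_distrr -!big_split; apply: eq_bigr => f _ /=.
by rewrite big_distrr -!big_split.
Qed.

(** Expand in all three positions: the term with three members in [X] vanishes, those with two are
    collected by [deg], and the rest by [pair_weight]. *)
Lemma ST_union X F : sumfree X ->
  (ST (X :|: F) <= \sum_(f in F) deg X f + \sum_(f in F) \sum_(f' in F) pair_weight X F f f')%N.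
Proof.
move=> /sumfree_ST; rewrite ST_triples => X0; rewrite ST_triples sum_deg sum_pair_weight.
have s1 B C := triples_subadd1 (X :|: F) X F B C (subxx _).
have s2 A C : (triples A (X :|: F) C <= triples A X C + triples A F C)%N.
  by rewrite !(triplesC _ A) s1.
have s3 A B := triples_subadd3 A B (X :|: F) X F (subxx _).
have := s1 (X :|: F) (X :|: F).
have := s2 X (X :|: F); have := s2 F (X :|: F).
have := s3 X X; have := s3 X F; have := s3 F X; have := s3 F F.
rewrite (triplesC _ X F X) (triplesC _ X F F); lia.
Qed.

Lemma deg_periodic H X g h : H \subset stab X -> h \in H -> deg X (g + h) = deg X g.
Proof.
move=> /subsetP HX hH; have /stabP st := HX h hH.
rewrite /deg; congr (_ + 2 * _)%N; apply: eq_bigr => x _; last by rewrite addrAC st.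
by rewrite addrAC st.
Qed.

Lemma deg_stab X h : h \in stab X -> (2 * #|X| <= deg X h)%N.
Proof.
move=> /stabP st; rewrite /deg; apply: leq_trans (leq_addl _ _); rewrite leq_mul2l card_mem_sum /=.
by apply: leq_sum => x _; rewrite addrC st; case: (x \in X).
Qed.

(** Pollard's inequality at level [(j + 1) * #|H|]. In the other alternative [beta > #|H|], so by
    primality of the index the stabiliser of [C] is the whole group; then [C] is everything, which
    is too large. The uses are [j = 1] and [j = 2], with bounds 4 and 12 times [#|H| ^ 2]. *)
Lemma periodic_ST_lower H Y (K j : nat) :
  subgroup H -> H \subset stab Y -> prime (3 * K + 2) -> #|G| = ((3 * K + 2) * #|H|)%N ->
  #|Y| = ((K + 1 + j) * #|H|)%N -> (j <= K + 1)%N -> (2 * j * (j + 1) * #|H| ^ 2 <= ST Y)%N.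
Proof.
move=> sH HY qp eG eY jK; have L0 := subgroup_gt0 _ _ sH.
have [||||le|] := pollard_kneser G H Y (opp_set Y) ((j + 1) * #|H|) 0 sH HY (periodic_opp _ _ _
  sH HY).
- exact: dvdn_mull.
- by rewrite muln_gt0 L0 addn1.
- by rewrite eY leq_mul2r; lia.
- by rewrite card_opp_set eY leq_mul2r; lia.
- have := trunc_rep_ST _ Y ((j + 1) * #|H|); move: le; rewrite card_opp_set eG eY.
  set L := #|H| in L0 *; set N := trunc_rep _ _ _; set S := ST Y.
  move=> leN; have [e eK] : exists e, (e + j = 2 * K + 1)%N by exists (2 * K + 1 - j)%N; lia.
  have eD : ((3 * K + 2) * L - (K + 1 + j) * L = e * L)%N by rewrite -mulnBl; congr muln; lia.
  have eM : ((j + 1) * L * (e * L) + (j + 1) * L * (j * L) = (j + 1) * L * ((2 * K + 1) * L))%N.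
    by rewrite -eK; ring.
  rewrite eD => leS; nia.
case=> C [beta [sigma [C0 HC sL [_ tb bC Cs _]]]].
exfalso.
have sS := stab_subgroup G C; set S := stab C in bC sS HC.
have HS : H \subset stab S.
  by apply/subsetP => h hH; apply/stabP => x; apply: subgroupDl => //; apply: subsetP hH.
have [s es] := dvdnP (periodic_dvd _ _ _ sH HS).
have [k ek] := dvdnP (subgroup_dvd _ _ sS).
have sq : (s %| 3 * K + 2)%N.
  by apply/dvdnP; exists k; apply/eqP; rewrite -(eqn_pmul2r L0) -mulnA -es -ek -eG.
have s1 : (1 < s)%N.
  rewrite -(ltn_pmul2r L0) mul1n -es; apply: leq_trans bC; lia.
have {}sq : s = (3 * K + 2)%N by apply/(prime_nt_dvdP qp) => //; rewrite gtn_eqF.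
have CG : (#|G| <= #|C|)%N.
  by rewrite eG -sq -es; apply: dvdn_leq => //; apply: periodic_dvd.
move: Cs; rewrite card_opp_set eY; move: CG; rewrite eG; nia.
Qed.

End Degrees.

Arguments deg {G}.
Arguments pair_weight {G}.

(** * Degrees outside an extremal periodic sum-free set of prime index *)

Section Local.
Variable G : finZmodType.
Implicit Types (A B C D E F H X : {set G}) (g h x y : G).

Lemma triples_superadd1 A A1 A2 B C : A1 \subset A -> A2 \subset A -> [disjoint A1 & A2] ->
  (triples A1 B C + triples A2 B C <= triples A B C)%N.
Proof.
move=> /subsetP s1 /subsetP s2 dis; rewrite -big_split; apply: leq_sum => x _.
rewrite -big_split; apply: leq_sum => y _ /=.
case x1: (x \in A1); first by rewrite (s1 _ x1) (disjointFr dis x1) addn0.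
by case x2: (x \in A2); rewrite ?(s2 _ x2).
Qed.

Lemma triples_superadd3 A B C C1 C2 : C1 \subset C -> C2 \subset C -> [disjoint C1 & C2] ->
  (triples A B C1 + triples A B C2 <= triples A B C)%N.
Proof.
move=> /subsetP s1 /subsetP s2 dis; rewrite -big_split; apply: leq_sum => x _.
rewrite -big_split; apply: leq_sum => y _ /=.
case x1: (x + y \in C1); first by rewrite (s1 _ x1) (disjointFr dis x1) muln0 addn0.
by rewrite muln0; case x2: (x + y \in C2); rewrite ?(s2 _ x2) ?muln0.
Qed.

Section PrimeIndex.
Variables (H X : {set G}) (K : nat).
Hypothesis sH : subgroup H.
Hypothesis HX : H \subset stab X.
Hypothesis qp : prime (3 * K + 2).
Hypothesis eG : #|G| = ((3 * K + 2) * #|H|)%N.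
Hypothesis eX : #|X| = ((K + 1) * #|H|)%N.
Hypothesis sX : sumfree X.

Local Notation L := #|H|.

Let L0 : (0 < L)%N. Proof. exact: subgroup_gt0. Qed.

Lemma sumfree_notin_subgroup h : h \in H -> h \notin X.
Proof.
move=> hH; apply/negP => hX; have := sX _ _ hX hX.
by have /stabP -> := subsetP HX h hH; rewrite hX.
Qed.

Lemma mem_same_coset x y : x - y \in H -> (x \in X) = (y \in X).
Proof. by move=> xyH; have /stabP/(_ y) <- := subsetP HX _ xyH; rewrite addrC subrK. Qed.

Lemma deg_coset x y : x - y \in H -> deg X x = deg X y.
Proof. by move=> xyH; rewrite -(deg_periodic _ H X y (x - y)) // addrC subrK. Qed.

Lemma coset_disjointX g : g \notin X -> [disjoint X & shift g H].
Proof.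
move=> gX; rewrite disjoint_sym; apply/pred0P => x /=; rewrite inE.
by apply/negP => /andP[/mem_same_coset -> ]; rewrite (negbTE gX).
Qed.

Lemma sum_deg_coset g : (\sum_(f in shift g H) deg X f = L * deg X g)%N.
Proof.
rewrite -(card_shift _ g H) -sum_nat_const; apply: eq_bigr => f.
by rewrite inE => /deg_coset.
Qed.

(** Adding the coset of [g] to [X] creates at least [4 * L ^ 2] triples, of which pairs inside that
    coset account for at most [L ^ 2]: their differences lie in [H], hence outside [X], and their
    sum cannot lie in both [X] and the coset. *)
Lemma deg_ge3 g : g \notin X -> (3 * L <= deg X g)%N.
Proof.
move=> gX; set D := shift g H.
have XD := coset_disjointX g gX.
have cXD : #|X :|: D| = ((K + 1 + 1) * L)%N.
  by move: XD; rewrite -leq_card_setU => /eqP ->; rewrite card_shift eX; ring.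
have HD : H \subset stab (X :|: D) by apply: periodicU => //; apply: shift_stab.
have lo := periodic_ST_lower _ H (X :|: D) K 1 sH HD qp eG cXD (leq_addl K 1).
have up := ST_union _ X D sX; rewrite sum_deg_coset in up.
have w1 : (\sum_(f in D) \sum_(f' in D) pair_weight X D f f' <= L * L)%N.
  rewrite -{1}(card_shift _ g H) -sum_nat_const; apply: leq_sum => f fD.
  rewrite -(muln1 L) -{1}(card_shift _ g H) -sum_nat_const; apply: leq_sum => f' f'D.
  have ffH : f' - f \in H.
    move: fD f'D; rewrite !inE => fD f'D; case: (sH) => _ /(_ _ _ f'D fD).
    by rewrite opprB addrA subrK.
  rewrite /pair_weight (negbTE (sumfree_notin_subgroup _ ffH)).
  case ffX: (f + f' \in X); first by rewrite (disjointFr XD ffX).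
  by case: (_ \in D).
nia.
Qed.

Lemma deg_subgroup h : (0 < K)%N -> h \in H -> (4 * L <= deg X h)%N.
Proof.
move=> K0 hH; apply: leq_trans (deg_stab _ X h (subsetP HX h hH)).
rewrite eX; nia.
Qed.

(** In the count of [deg_ge3], if [g + g] were outside [X] the pair weights would vanish, giving
    [deg X g >= 4 * L]. A sum falling back into the coset would put [g] in [H], where degrees are at
    least [4 * L]. *)
Lemma low_deg_double g f f' : (0 < K)%N -> g \notin X -> (deg X g < 4 * L)%N ->
  f - g \in H -> f' - g \in H -> f + f' \in X.
Proof.
move=> K0 gX dg fg f'g; set D := shift g H.
have XD := coset_disjointX g gX.
have cXD : #|X :|: D| = ((K + 1 + 1) * L)%N.
  by move: XD; rewrite -leq_card_setU => /eqP ->; rewrite card_shift eX; ring.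
have HD : H \subset stab (X :|: D) by apply: periodicU => //; apply: shift_stab.
have lo := periodic_ST_lower _ H (X :|: D) K 1 sH HD qp eG cXD (leq_addl K 1).
have up := ST_union _ X D sX; rewrite sum_deg_coset in up.
have gg u v : u - g \in H -> v - g \in H -> (u + v \in X) = (g + g \in X).
  by move=> uH vH; apply: mem_same_coset; rewrite opprD addrACA subgroupD.
rewrite (gg f f') //; apply/negPn/negP => ggX.
suff w0 : (\sum_(f in D) \sum_(f' in D) pair_weight X D f f' = 0)%N by nia.
apply: big1 => u; rewrite inE => uD; apply: big1 => v; rewrite inE => vD.
have uvH : v - u \in H.
  by case: (sH) => _ /(_ _ _ vD uD); rewrite opprB addrA subrK.
rewrite /pair_weight (negbTE (sumfree_notin_subgroup _ uvH)) (gg u v) // (negbTE ggX) inE.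
case E: (_ \in H) => //; exfalso.
have uH : u \in H by case: (sH) => _ /(_ _ _ E vD); rewrite opprB addrA subrK addrK.
by have := deg_subgroup u K0 uH; rewrite (deg_coset u g) // leqNgt dg.
Qed.

(** Adding both cosets creates at least [12 * L ^ 2] triples, while the degrees supply less than
    [8 * L ^ 2]. Without a triple meeting [X], only pairs within one coset carry weight, at most
    [2 * L ^ 2] in all. *)
Lemma low_deg_pair g g' : (0 < K)%N -> g \notin X -> g' \notin X ->
  (deg X g < 4 * L)%N -> (deg X g' < 4 * L)%N -> g' - g \notin H ->
  [|| g + g' \in X, g' - g \in X | g - g' \in X].
Proof.
move=> K0 gX g'X dg dg' gg'; apply/negPn/negP; rewrite !negb_or => /and3P[n1 n2 n3].
set F := shift g' H :|: shift g H.
have D12 : [disjoint shift g' H & shift g H] by apply: coset_disjoint.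
have XF : [disjoint X & F].
  by rewrite -setI_eq0 setIUr setU_eq0 !setI_eq0 !coset_disjointX.
have cF : (#|F| = 2 * L)%N.
  by move: D12; rewrite -leq_card_setU => /eqP ->; rewrite !card_shift mul2n addnn.
have cXF : #|X :|: F| = ((K + 1 + 2) * L)%N.
  by move: XF; rewrite -leq_card_setU => /eqP ->; rewrite cF eX; ring.
have HF : H \subset stab (X :|: F).
  by apply: periodicU => //; apply: periodicU; apply: shift_stab.
have K2 : (2 <= K + 1)%N by rewrite addn1 ltnS.
have lo := periodic_ST_lower _ H (X :|: F) K 2 sH HF qp eG cXF K2.
have up := ST_union _ X F sX.
have sd : (\sum_(f in F) deg X f = L * deg X g' + L * deg X g)%N.
  rewrite -!sum_deg_coset big_mkcond [X in _ = (X + _)%N]big_mkcond [X in _ = (_ + X)%N]big_mkcond.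
  rewrite -big_split; apply: eq_bigr => f _ /=; rewrite in_setU.
  case f1: (f \in shift g' H); first by rewrite (disjointFr D12 f1) addn0.
  by case: (_ \in _).
rewrite sd in up.
have dL u : (deg X u < 4 * L -> L * deg X u <= L * (4 * L))%N by rewrite leq_mul2l => /ltnW ->;
  rewrite orbT.
suff w2 : (\sum_(f in F) \sum_(f' in F) pair_weight X F f f' <= 2 * L * L)%N.
  have := dL _ dg; have := dL _ dg'; have : (0 < L * L)%N by rewrite muln_gt0 L0.
  by move: lo up w2; clear; lia.
rewrite -cF -sum_nat_const; apply: leq_sum => f fF.
apply: (@leq_trans (\sum_(f' in F) (f' - f \in H)%R)%N); last first.
  rewrite -(card_shift _ f H) card_mem_sum big_mkcond; apply: leq_sum => f' _.
  by case: ifP => // _; rewrite inE.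
apply: leq_sum => f' f'F; rewrite /pair_weight.
have coF u : u \in F -> u - g' \in H \/ u - g \in H by rewrite !inE => /orP.
have nH u : u \in F -> u \notin H.
  move=> /coF uF; apply/negP => uH; have := deg_subgroup u K0 uH.
  by case: uF => /deg_coset ->; rewrite leqNgt ?dg ?dg'.
have HB u v : u \in H -> v \in H -> u - v \in H by case: (sH) => _; apply.
have [ffH|ffH] := boolP (f' - f \in H).
  rewrite (negbTE (sumfree_notin_subgroup _ ffH)).
  case ffX: (f + f' \in X); first by rewrite (disjointFr XF ffX).
  by case: (_ \in F).
(* If the sum lay in [F], then [f] or [f'] would lie in [H], which low degree forbids. *)
have ffF : f + f' \notin F.
  have key u v r : u - r \in H -> v \in F -> u + v - r \notin H.
    move=> ur /nH; apply: contra => uvr; have := HB _ _ uvr ur.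
    by rewrite (addrAC u) [u - r + v]addrC addrK.
  have fF' := coF _ fF; have f'F' := coF _ f'F; rewrite !inE negb_or; apply/andP.
  case: fF' f'F' => [a|a] [b|b].
  - by case/negP: ffH; have := HB _ _ b a; rewrite opprB addrA subrK.
  - by split; [exact: key|rewrite (addrC f); exact: key].
  - by split; [rewrite (addrC f); exact: key|exact: key].
  - by case/negP: ffH; have := HB _ _ b a; rewrite opprB addrA subrK.
rewrite (negbTE ffF).
have dif u v r s : u - r \in H -> v - s \in H -> (u - v \in X) = (r - s \in X).
  move=> uH vH; apply: mem_same_coset; have := HB _ _ uH vH.
  by rewrite !opprB addrACA [- r + _]addrC -addrACA.
have add u v r s : u - r \in H -> v - s \in H -> (u + v \in X) = (r + s \in X).
  by move=> uH vH; apply: mem_same_coset; rewrite opprD addrACA subgroupD.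
case: (coF _ fF) (coF _ f'F) => [a|a] [b|b].
- by case/negP: ffH; have := HB _ _ b a; rewrite opprB addrA subrK.
- by rewrite (add _ _ _ _ a b) (dif _ _ _ _ b a) addrC (negbTE n1) (negbTE n3).
- by rewrite (add _ _ _ _ a b) (dif _ _ _ _ b a) (negbTE n1) (negbTE n2).
- by case/negP: ffH; have := HB _ _ b a; rewrite opprB addrA subrK.
Qed.

End PrimeIndex.

End Local.

(** * Triples in a set close to such a sum-free set *)

Section Perturbation.
Variable G : finZmodType.
Implicit Types (A B C D E F H X : {set G}) (g h x y : G).

Lemma triples_card12 A B C : (triples A B C <= #|A| * #|B|)%N.
Proof.
rewrite card_mem_sum big_distrl; apply: leq_sum => x _ /=.
rewrite (card_mem_sum _ B) big_distrr /=; apply: leq_sum => y _.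
by case: (_ \in C); rewrite ?muln1 ?muln0.
Qed.

(** Triples inside [A :&: X] are dropped. Those with at least two members outside [X] are kept only
    for [B'], later the points of low degree. *)
Lemma ST_decompose A X B' : B' \subset A :\: X ->
  (triples (A :&: X) (A :&: X) (A :\: X) + 2 * triples (A :\: X) (A :&: X) (A :&: X) +
   (triples B' B' (A :&: X) + 2 * triples B' (A :&: X) B' + triples B' B' B') <= ST A)%N.
Proof.
move=> sB; rewrite ST_triples; set Y := A :&: X; set B := A :\: X in sB *.
have YA : Y \subset A by apply: subsetIl.
have BA : B \subset A by apply: subsetDl.
have dis : [disjoint Y & B].
  by rewrite -setI_eq0; apply/eqP/setP => x; rewrite !inE; case: (x \in X); rewrite !andbF.
have s1 C D := triples_superadd1 _ A Y B C D YA BA dis.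
have s2 C D : (triples C Y D + triples C B D <= triples C A D)%N.
  by rewrite !(triplesC _ C) s1.
have s3 C D := triples_superadd3 _ C D A Y B YA BA dis.
have b1 : (triples B' B' Y <= triples B B Y)%N by apply: triples_le.
have b2 : (triples B' Y B' <= triples B Y B)%N by apply: triples_le.
have b3 : (triples B' B' B' <= triples B B B)%N by apply: triples_le.
have p1 := s1 A A; have p2 := s2 Y A; have p3 := s2 B A.
have p4 := s3 Y Y; have p5 := s3 Y B; have p6 := s3 B Y; have p7 := s3 B B.
move: p1 p2 p3 p4 p5 p6 p7 b1 b2 b3; rewrite !(triplesC _ Y B).
move: (triples A A A) (triples Y A A) (triples B A A) (triples Y Y A) (triples B Y A)
  (triples B B A) (triples Y Y Y) (triples Y Y B) (triples B Y Y) (triples B Y B)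
  (triples B B Y) (triples B B B) (triples B' B' Y) (triples B' Y B') (triples B' B' B').
by clear; lia.
Qed.

(** Replacing [X] by [A :&: X] in one position costs at most [#|X :\: A| * #|B|]; the weighted
    number of positions is 2 + 2 * 2. *)
Lemma sum_deg_loss A X B :
  (\sum_(b in B) deg X b <= triples (A :&: X) (A :&: X) B + 2 * triples B (A :&: X) (A :&: X) +
   6 * (#|X :\: A| * #|B|))%N.
Proof.
set Y := A :&: X; set E := X :\: A; rewrite sum_deg.
have YE : X \subset Y :|: E by rewrite /Y setIC setID.
have c1 := triples_subadd1 _ X Y E X B YE.
have c2 := triples_subadd1 _ X Y E Y B YE; rewrite (triplesC _ X Y B) in c2.
have c3 := triples_subadd3 _ B X X Y E YE.
have c4 := triples_subadd1 _ X Y E B Y YE; rewrite (triplesC _ X B Y) (triplesC _ Y B Y) in c4.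
have b1 := triples_card13 _ E X B; have b2 := triples_card13 _ E Y B.
have b3 := triples_card13 _ B X E; have b4 := triples_card12 E B Y.
rewrite [(#|B| * _)%N]mulnC in b3.
move: c1 c2 c3 c4 b1 b2 b3 b4; move: (#|E| * #|B|)%N; clear; lia.
Qed.

Lemma pair_weight_loss A X B :
  (\sum_(f in B) \sum_(f' in B) pair_weight X B f f' <=
   triples B B (A :&: X) + 2 * triples B (A :&: X) B + triples B B B +
   3 * (#|X :\: A| * #|B|))%N.
Proof.
set Y := A :&: X; set E := X :\: A; rewrite sum_pair_weight.
have YE : X \subset Y :|: E by rewrite /Y setIC setID.
have c1 := triples_subadd3 _ B B X Y E YE.
have c2 := triples_subadd1 _ X Y E B B YE; rewrite (triplesC _ X B B) (triplesC _ Y B B) in c2.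
have b1 := triples_card13 _ B B E; have b2 := triples_card13 _ E B B.
rewrite [(#|B| * _)%N]mulnC in b1.
move: c1 c2 b1 b2; move: (#|E| * #|B|)%N; clear; lia.
Qed.

(** Here [b1] and [b2] count the points of low and high degree and [e] the holes. Since [b = s + e],
    the degree sum contains [3 * L * e], which pays for both losses as [3 * b <= L]; the surplus
    [L * b2] completes [b1 ^ 2] to at least [b ^ 2]. *)
Lemma perturbation_arith (L S b b1 b2 e s D W : nat) :
  (b = s + e -> b = b1 + b2 -> 3 * b <= L -> 3 * L * b + L * b2 <= D -> b1 ^ 2 <= W ->
   D + W <= S + 6 * (e * b) + 3 * (e * b1) -> 3 * s * L + s ^ 2 <= S)%N.
Proof.
move=> bE b12 bL hD hW hS.
have x1 : (9 * (b * e) <= 3 * (L * e))%N by nia.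
have x2 : (2 * (b * b2) <= L * b2)%N by nia.
have x3 : (e * b1 <= e * b)%N by nia.
have x4 : (s ^ 2 <= b ^ 2)%N by rewrite leq_exp2r //; lia.
have x5 : (b ^ 2 <= b1 ^ 2 + 2 * (b * b2))%N.
  have : (b ^ 2 + b2 ^ 2 = b1 ^ 2 + 2 * (b * b2))%N by rewrite b12; ring.
  lia.
move: hD; rewrite {1}bE; move: hS x1 x2 x3 x4 x5 hW; clear; nia.
Qed.

Lemma ST_near_sumfree H X A (K s : nat) :
  subgroup H -> H \subset stab X -> prime (3 * K + 2) -> #|G| = ((3 * K + 2) * #|H|)%N ->
  #|X| = ((K + 1) * #|H|)%N -> sumfree X ->
  (3 * #|A :\: X| <= #|H|)%N -> #|A :\: X| = (s + #|X :\: A|)%N ->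
  (3 * s * #|H| + (0 < K)%N * s ^ 2 <= ST A)%N.
Proof.
move=> sH HX qp eG eX sX BL Bs.
set B := A :\: X in BL Bs *; set E := X :\: A in Bs *.
(* The points of low degree. For [K = 0], that is index 2, this set is empty and only the linear
   term is claimed. *)
pose B1 := [set b in B | (0 < K)%N && (deg X b < 4 * #|H|)%N].
have BX b : b \in B -> b \notin X by rewrite inE => /andP[].
have sB1 : B1 \subset B by apply/subsetP => b; rewrite inE => /andP[].
have dec := ST_decompose A X B1 sB1.
have l1 := sum_deg_loss A X B.
have l2 := pair_weight_loss A X B1.
have hD : (3 * #|H| * #|B| + (0 < K)%N * (#|H| * (#|B| - #|B1|)) <= \sum_(b in B) deg X b)%N.
  rewrite -cardsDS // -[in X in (X <= _)%N](setIidPr (subsetDl B B1)).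
  rewrite mulnC -sum_nat_const.
  have -> : ((0 < K)%N * (#|H| * #|B :&: (B :\: B1)|) = \sum_(b in B) (0 < K)%N * ((b \notin B1)
    * #|H|))%N.
    rewrite -big_distrr /= [(#|H| * _)%N]mulnC (card_mem_sum _ (_ :&: _)) big_distrl /=; congr muln.
    rewrite [RHS]big_mkcond; apply: eq_bigr => b _; rewrite in_setI in_setD.
    by case: (b \in B); rewrite ?andbT.
  rewrite -big_split; apply: leq_sum => b bB /=.
  have d3 := deg_ge3 _ H X K sH HX qp eG eX sX b (BX _ bB).
  case K0: (0 < K)%N; rewrite ?mul0n ?addn0 // mul1n inE bB K0 /= -leqNgt.
  by case: (leqP (4 * #|H|) (deg X b)) => [d4|_]; [rewrite mul1n addnC -mulSn|rewrite addn0].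
have hW : ((0 < K)%N * #|B1| ^ 2 <= \sum_(f in B1) \sum_(f' in B1) pair_weight X B1 f f')%N.
  case K0: (0 < K)%N => //; rewrite mul1n.
  have -> : (#|B1| ^ 2 = \sum_(f in B1) \sum_(f' in B1) 1)%N by rewrite !sum_nat_const muln1.
  (* [low_deg_pair] does not say which difference is in [X], so the pairs [(f, f')] and [(f', f)]
     are added: together they weigh at least 2. *)
  rewrite -leq_double -!addnn {2}exchange_big [X in (_ <= _ + X)%N]exchange_big -!big_split /=.
  apply: leq_sum => f fB; rewrite -!big_split /=; apply: leq_sum => f' f'B.
  move: fB f'B; rewrite !inE K0 /= => /andP[/andP[fX _] df] /andP[/andP[f'X _] df'].
  rewrite /pair_weight [f' + f]addrC.
  have [ffH|ffH] := boolP (f' - f \in H).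
    have f0 : f - f \in H by rewrite subrr; case: sH.
    have -> := low_deg_double _ H X K sH HX qp eG eX sX f f f' K0 fX df f0 ffH.
    by clear; lia.
  have := low_deg_pair _ H X K sH HX qp eG eX sX f f' K0 fX f'X df df' ffH.
  by case/or3P => ->; clear; lia.
have cB : (#|B| = #|B1| + (#|B| - #|B1|))%N by rewrite subnKC // subset_leq_card.
have [K0|K0] := posnP K; last first.
  rewrite K0 !mul1n in hD hW *; apply: (perturbation_arith _ _ _ _ _ _ _ _ _ Bs cB BL hD hW).
  by move: dec l1 l2; rewrite -/B -/E; clear; lia.
rewrite K0 !mul0n !addn0 in hD *.
have B10 : B1 = set0 by apply/setP => b; rewrite !inE K0 andbF.
move: dec l1 hD; rewrite -/B -/E Bs; move: BL; rewrite Bs; clear; nia.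
Qed.

End Perturbation.

(** * Sets with few Schur triples *)

(** The hypotheses give [t * (h + 3 * s - 2 * t) <= S], and with [t] about [h / 32] the left side is
    far above [h ^ 2 / 500]. *)
Lemma unstructured_arith (t h s a n N S : nat) :
  (3 * a = n + h + 3 * s -> a <= n -> 32 * t <= h -> h < 32 * (t + 1) -> 2000 <= h ->
   500 * S <= h ^ 2 -> t * (a + a) <= N + t * (t + t) -> N <= t * (n - a) + S -> False)%N.
Proof.
move=> ea an th ht h2 hS l1 l2.
have l3 : (t * (h + 3 * s) <= S + t * (2 * t))%N.
  have : (t * (n - a) + t * a = t * n)%N by rewrite -mulnDr subnK.
  have : (t * (3 * a) = t * (n + h + 3 * s))%N by rewrite ea.
  by move: l1 l2; clear; lia.
have l4 : (15 * (t * h) <= 16 * S)%N.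
  have : (t * (32 * t) <= t * h)%N by rewrite leq_mul2l th orbT.
  by move: l3; clear; lia.
have l5 : (h * h <= 32 * (t * h) + 32 * h)%N by rewrite mulnA -mulnDl leq_mul2r; lia.
have l6 : (2000 * h <= h * h)%N by rewrite leq_mul2r h2 orbT.
by move: hS l4 l5 l6 h2; rewrite -mulnn; clear; lia.
Qed.

Section Structure.
Variable G : finZmodType.
Implicit Types (A B C D E F H X : {set G}) (g h x y : G).

Lemma few_triples_structure p A (s : nat) (h := (#|G| %/ p)%N) :
  typeI G p -> (3 * #|A| = #|G| + h + 3 * s)%N -> (2000 * s <= h)%N -> (2000 <= h)%N ->
  (500 * ST A <= h ^ 2)%N ->
  exists H X (K : nat),
    [/\ subgroup H, H \subset stab X, prime (3 * K + 2) & [/\ #|G| = ((3 * K + 2) * #|H|)%N,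
        #|X| = ((K + 1) * #|H|)%N, sumfree X, (10 * #|A :\: X| <= h)%N & (#|H| <= h <= 2 *
          #|H|)%N]].
Proof.
move=> pI eA sh h2000 fewST; have [h0 eh] := typeI_cofactor _ _ pI; rewrite -/h in eh h0.
set t := (h %/ 32)%N.
have [t1 t2 t3] : [/\ 0 < t, 32 * t <= h & h < 32 * (t + 1)]%N by rewrite /t; split; lia.
(* The error is also set to [t], so that [beta > t]. *)
have [||||le|] := pollard_kneser G [set 0] A (opp_set A) t t (subgroup0 _) (periodic0 _ _)
  (periodic0 _ _) => //.
- by rewrite cards1.
- lia.
- rewrite card_opp_set; lia.
- exfalso; have lo := trunc_rep_ST _ A t; rewrite card_opp_set in le.
  by apply: (unstructured_arith _ _ _ _ _ _ _ eA _ t2 t3 h2000 fewST le lo); apply: max_card.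
case=> C [beta [sigma [C0 _]]]; rewrite cards1 card_opp_set => st [tb _ bC Cs rC].
(* From [beta > t] follows [h <= 32 * beta]; as 32/500 < 1/10, the overlap of [A] and [C] is then at
   most [h / 10]. *)
have CA : (h * #|A :&: C| <= 32 * ST A)%N.
  have pop := popular_ST _ _ _ _ rC.
  apply: (@leq_trans (32 * (beta * #|A :&: C|))%N); last by rewrite leq_mul2l pop orbT.
  by rewrite mulnA leq_mul2r; lia.
have {}CA : (10 * #|A :&: C| <= h)%N.
  rewrite -(leq_pmul2l h0) mulnCA; move: CA fewST; rewrite -mulnn; clear; lia.
have sK := stab_subgroup G C; set H := stab C in bC sK.
have L0 := subgroup_gt0 _ _ sK.
have [c ec] := dvdnP (periodic_dvd _ _ _ sK (subxx _)).
have [m em] := dvdnP (subgroup_dvd _ _ sK).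
have dm : (#|G| %/ #|H|)%N = m by rewrite em mulnK.
have m2 : (m %% 3 = 2 -> #|H| <= h)%N by rewrite -dm; apply: typeI_index_card.
have cC : (#|C| + #|~: C| = #|G|)%N := cardsC C.
have cA : (#|A :&: C| + #|A :\: C| = #|A|)%N := cardsID C A.
have cA' : (#|A :\: C| + #|~: C :\: A| = #|~: C|)%N.
  rewrite -(cardsID A (~: C)); congr addn; apply: eq_card => x; by rewrite !inE andbC.
have AC : #|A :\: ~: C| = #|A :&: C| by rewrite setDE setCK.
have HC : H \subset stab (~: C) by apply: periodicC.
have c_ub : (3 * c < 2 * m)%N.
  rewrite -(ltn_pmul2r L0) -!mulnA -ec -em; lia.
have c_lb : (2 * m < 3 * c + 3)%N.
  rewrite -(ltn_pmul2r L0) mulnDl -!mulnA -ec -em; lia.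
have [e|e] : (3 * c + 1 = 2 * m \/ 3 * c + 2 = 2 * m)%N by lia.
  have m3 : (m %% 3 = 2)%N by lia.
  have Lh : (#|H| <= h)%N by apply: m2.
  have e3 : (3 * #|C| + #|H| = 2 * #|G|)%N by rewrite ec em; move: e; clear; nia.
  (* This bounds the index [m] by [10 * p / 7], below the [2 * p] needed for primality. *)
  have hL : (7 * h <= 10 * #|H|)%N by lia.
  have mp : prime m.
    apply: (typeI_index_prime _ _ _ pI) => //; first by rewrite em dvdn_mulr.
    rewrite ltnNge; apply/negP => pm.
    have : (2 * p * #|H| <= p * h)%N by rewrite eh em leq_mul2r pm orbT.
    have p0 : (0 < p)%N by case: pI => /prime_gt0.
    by rewrite mulnAC mulnC leq_pmul2l //; lia.
  have mK : (3 * (m %/ 3) + 2 = m)%N by lia.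
  exists H, (~: C), (m %/ 3)%N; split; rewrite ?mK //; split=> //; last by lia.
  - have : (m * #|H| = 3 * (m %/ 3 * #|H|) + 2 * #|H|)%N by rewrite -{1}mK; ring.
    by rewrite mulnDl mul1n -em; lia.
  - apply: (almost_periodic_sumfree _ H _ A) => //; try lia.
    by move: fewST hL h0; rewrite -!mulnn; clear; nia.
  - by rewrite AC.
(* Now [m] is congruent to 1 modulo 3, and the complement of [C] has [(n + 2 * #|H|) / 3] elements,
   [n] being the order of [G]: too many for a sum-free set once [#|H| >= 9 * h / 5]. *)
have e3 : (3 * #|C| + 2 * #|H| = 2 * #|G|)%N by rewrite ec em; move: e; clear; nia.
have hL : (18 * h <= 10 * #|H|)%N by lia.
have sC : sumfree (~: C).
  apply: (almost_periodic_sumfree _ H _ A) => //; try lia; last first.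
    by move: fewST hL h0; rewrite -!mulnn; clear; nia.
  left; have c0 : (0 < c)%N by case: (c) ec C0 => // ->.
  have : (4 * #|H| <= #|G|)%N by rewrite em leq_mul2r; lia.
  lia.
have := sumfree_bound _ _ _ pI sC; rewrite -/h; lia.
Qed.

End Structure.

Lemma ST_lower_bound (G : finZmodType) p (A : {set G}) (s : nat) (h := (#|G| %/ p)%N) :
  typeI G p -> (3 * #|A| = #|G| + h + 3 * s)%N -> (2000 * s <= h)%N ->
  (3 * s * h + (p != 2)%N * s ^ 2 <= ST A)%N.
Proof.
move=> pI eA sh; have [h0 eh] := typeI_cofactor _ _ pI; rewrite -/h in eh h0.
have [->|s0] := posnP s; first by rewrite !muln0.
rewrite leqNgt; apply/negP => few.
have few500 : (500 * ST A <= h ^ 2)%N.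
  have l1 : (ST A <= 3 * s * h + s ^ 2)%N.
    by apply: leq_trans (ltnW few) _; rewrite leq_add2l; case: (p != 2%N); rewrite ?mul1n.
  have l2 : (2000 * s * h <= h * h)%N by rewrite leq_mul2r sh orbT.
  have l3 : (s * (2000 * s) <= s * h)%N by rewrite leq_mul2l sh orbT.
  by move: l1 l2 l3; rewrite -!mulnn; clear; lia.
have [|H [X [K [sH HX qp [eG eX sX BL /andP[Lh hL]]]]]] :=
  few_triples_structure _ _ _ _ pI eA sh _ few500; first lia.
rewrite -/h in BL Lh hL.
have cA := cardsID X A; have cX := cardsID A X; rewrite setIC in cX.
pose u := (#|A| - #|X|)%N.
have eL : (3 * #|X| = #|G| + #|H|)%N by rewrite eX eG; ring.
have eu : (3 * u + #|H| = h + 3 * s)%N by rewrite /u; lia.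
have Bu : #|A :\: X| = (u + #|X :\: A|)%N by rewrite /u; lia.
have := ST_near_sumfree _ H X A K u sH HX qp eG eX sX ltac:(lia) Bu.
rewrite leqNgt => /negP; apply; apply: leq_trans few _.
apply: leq_add.
  (* With [h = #|H| + d], the linear term for [u] is [#|H| * (d + 3 * s)]; it dominates [3 * s * h]
     because [3 * s <= #|H|]. *)
  have : (#|H| * (3 * u + #|H|) = #|H| * (h + 3 * s))%N by rewrite eu.
  have [d ed] : exists d, h = (#|H| + d)%N by exists (h - #|H|)%N; lia.
  have : (3 * s * d <= #|H| * d)%N by rewrite leq_mul2r; lia.
  by rewrite ed; clear; lia.
have su : (s <= u)%N by lia.
apply: leq_mul; last by rewrite leq_exp2r.
(* [K = 0] means index 2, and then [p * h <= 2 * h] forces [p = 2]: the quadratic term is missing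
   only when it is not claimed. *)
case: (K) eG => [|k] eG; last exact: leq_b1.
rewrite ltnn leqn0 eqb0 negbK.
have p2 : (1 < p)%N by case: pI => /prime_gt1.
have : (p * h <= 2 * h)%N by rewrite eh eG leq_mul2l Lh orbT.
rewrite leq_pmul2r // => p2'; lia.
Qed.

Theorem theorem1p4 (R : realType) :
  exists delta : R, 0 < delta /\
    forall (p : nat) (G : finZmodType) (t : R) (A : {set G}),
      prime p -> p = 2 %[mod 3] -> typeI G p ->
      0 <= t -> t <= delta * #|G|%:R / p%:R ->
      #|A|%:R = (1 / 3 + 1 / (3 * p%:R)) * #|G|%:R + t ->
      3 * t * #|G|%:R / p%:R + (p != 2)%N%:R * t ^+ 2 <= (ST A)%:R.
Proof.
(* This constant becomes the condition [2000 * s <= h] of [ST_lower_bound]. *)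
exists (2000%:R)^-1; split; first by rewrite invr_gt0 ltr0n.
move=> p G t A pp p2 pI t0 tle cA.
have [h0 eh] := typeI_cofactor _ _ pI; set h := (_ %/ p)%N in h0 eh.
have pR : p%:R != 0 :> R by rewrite pnatr_eq0 -lt0n prime_gt0.
have GR : #|G|%:R = p%:R * h%:R :> R by rewrite -eh natrM.
have Gp : #|G|%:R / p%:R = h%:R :> R by rewrite GR mulrAC divff // mul1r.
have cA3 : (3 * #|A|)%:R = (#|G| + h)%:R + 3 * t :> R.
  by rewrite natrM cA natrD GR; field; rewrite pR.
have le : (#|G| + h <= 3 * #|A|)%N by rewrite -(ler_nat R) cA3 lerDl mulr_ge0.
(* Divisibility of [p + 1] by 3 makes the real number [t] a natural number. *)
have d3 : (3 %| #|G| + h)%N.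
  have -> : (#|G| + h = (p + 1) * h)%N by rewrite -eh; ring.
  by apply: dvdn_mulr; rewrite /dvdn -modnDml p2.
have [s es] : exists s, (3 * #|A| = #|G| + h + 3 * s)%N.
  by have [k ek] := dvdnP d3; exists (#|A| - k)%N; move: le ek; clear; lia.
have ts : t = s%:R.
  move: cA3; rewrite es natrD => /addrI; rewrite natrM; move/mulfI => -> //.
  by rewrite pnatr_eq0.
have sh : (2000 * s <= h)%N.
  by rewrite -(ler_nat R) natrM -ts mulrC -ler_pdivlMr ?ltr0n // mulrC -Gp mulrA.
have := ST_lower_bound G p A s pI es sh; rewrite -(ler_nat R) natrD [X in _ + X <= _]natrM natrX
  !natrM -ts -/h.
by rewrite -[3 * t * _ / _]mulrA Gp.
Qed.
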